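(* Let $X$ be a compact Hausdorff space equipped with a continuous action of an amenable group $G$ and let $Y \subsetneqq X$ be a proper closed $G$-invariant subset of $X$. Suppose that the action of $G$ on $X$ has the weak specification property and that the action of $G$ on $Y$ is expansive. Then $h_{\mathrm{top}}(Y,G) < h_{\mathrm{top}}(X,G)$.
   Context: An action of a group $G$ on a topological space $X$ is continuous if $x \mapsto gx$ is continuous for every $g \in G$. A subset $Y \subset X$ is $G$-invariant if $gY = Y$ for all $g \in G$; then $G$ acts on $Y$ by restriction. A compact Hausdorff space is regarded as a uniform space with its unique compatible uniform structure, whose entourages are the neighborhoods of the diagonal. A group $G$ is amenable if there is a left Følner net, i.e. a net $(F_j)_{j\in J}$ of nonempty finite subsets of $G$ with $\lim_j |gF_j \setminus F_j|/|F_j| = 0$ for all $g \in G$. Expansive (for the action on $Y$): there is an entourage $U_0$ of $Y$ such that for all $x \neq y$ in $Y$ there is $g \in G$ with $(gx,gy) \notin U_0$. Weak specification property (for the action on $X$): for every entourage $U$ of $X$ there is a finite subset $\Lambda \subset G$ such that for any finite family $(\Omega_i)_{i \in I}$ of finite subsets of $G$ with $\Omega_j \cap \Lambda\Omega_k = \varnothing$ for all distinct $j,k \in I$, and for any family $(x_i)_{i \in I}$ of points of $X$, there is a point $x \in X$ with $(gx,gx_i) \in U$ for all $i \in I$ and $g \in \Omega_i$. Topological entropy (of a topological space $Z$ with a continuous action of $G$): for a finite open cover $\alpha$ of $Z$, $N(\alpha)$ is the minimal cardinality of a subcover of $\alpha$. For a finite subset $F \subset G$, $\alpha^{(F)} =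 \bigvee_{g \in F} g^{-1}\alpha$, where $g^{-1}\alpha = \{g^{-1}A : A \in \alpha\}$ and $\alpha \vee \beta = \{A \cap B : A \in \alpha, B \in \beta\}$. Put $h_{\mathrm{top}}(Z,G,\alpha) = \lim_{j} \frac{\log N(\alpha^{(F_j)})}{|F_j|}$ for a left Følner net $(F_j)$ of $G$ (the limit exists, is finite, and does not depend on the choice of the net), and $h_{\mathrm{top}}(Z,G) = \sup_\alpha h_{\mathrm{top}}(Z,G,\alpha) \le \infty$ over all finite open covers $\alpha$ of $Z$. *)

(* Defs.v *)
From HB Require Import structures.
From mathcomp Require Import all_boot all_order all_algebra finmap.
From mathcomp Require Import all_classical all_reals all_analysis.

Set Implicit Arguments.
Unset Strict Implicit.
Unset Printing Implicit Defensive.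

Import Order.TTheory GRing.Theory Num.Theory.
Import numFieldNormedType.Exports.

Local Open Scope classical_set_scope.
Local Open Scope ring_scope.

(* [groupType] covers infinite groups; they carry no topology. *)

Definition fset_lmul (G : groupType) (g : G) (F : {fset G}) : {fset G} :=
  [fset (g * h)%g | h in F]%fset.

Definition fset_mul (G : groupType) (A B : {fset G}) : {fset G} :=
  [fset (g * h)%g | g in A, h in B]%fset.

Record directedSet := DirectedSet {
  directed_sort :> Type;
  directed_le : directed_sort -> directed_sort -> Prop;
  directed_inhabited : inhabited directed_sort;
  directed_refl : forall j, directed_le j j;
  directed_trans : forall i j k,
    directed_le i j -> directed_le j k -> directed_le i k;
  directed_ub : forall i j, exists k, directed_le i k /\ directed_le j k
}.

(* Convergence of a net u : J -> T to l is [u @ tails J --> l]. *)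
Definition tails (J : directedSet) : set_system J :=
  filter_from [set: J] (fun j => [set k | directed_le j k]).
Arguments tails : clear implicits.

Definition left_folner_net (R : realType) (G : groupType) (J : directedSet)
    (F : J -> {fset G}) : Prop :=
  (forall j, F j != fset0) /\
  (forall g : G,
     (fun j => (#|` (fset_lmul g (F j) `\` F j)%fset|)%:R / (#|` F j|)%:R : R)
       @ tails J --> (0 : R)).

Definition amenable (R : realType) (G : groupType) : Prop :=
  exists (J : directedSet) (F : J -> {fset G}), left_folner_net R F.

Definition continuous_action (G : groupType) (Z : topologicalType)
    (act : G -> Z -> Z) : Prop :=
  [/\ forall z, act 1%g z = z,
      forall g h z, act (g * h)%g z = act g (act h z) &
      forall g, continuous (act g)].

Definition invariant_set (G : groupType) (X : Type) (act : G -> X -> X)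
    (Y : set X) : Prop := forall g, act g @` Y = Y.

Lemma invariant_act (G : groupType) (X : Type) (act : G -> X -> X) (Y : set X)
  (invY : invariant_set act Y) (g : G) (y : Y) : act g (set_val y) \in Y.
Proof.
apply/mem_set.
have : (act g @` Y) (act g (set_val y)).
  by exists (set_val y) => //; apply/set_mem; exact: (valP y).
by rewrite invY.
Qed.

Definition restricted_action (G : groupType) (X : Type) (act : G -> X -> X)
    (Y : set X) (invY : invariant_set act Y) (g : G) (y : Y) : Y :=
  exist _ (act g (set_val y)) (invariant_act invY g y).

(* The entourages of the unique compatible uniform structure of a compact
   Hausdorff space are the neighborhoods of the diagonal. *)
Definition compact_entourage (Z : topologicalType) (U : set (Z * Z)) : Prop :=
  set_nbhs diagonal U.

Definition expansive (G : groupType) (Z : topologicalType)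
    (act : G -> Z -> Z) : Prop :=
  exists2 U0 : set (Z * Z), compact_entourage U0 &
    forall x y : Z, x <> y -> exists g : G, ~ U0 (act g x, act g y).

Definition weak_specification (G : groupType) (Z : topologicalType)
    (act : G -> Z -> Z) : Prop :=
  forall U : set (Z * Z), compact_entourage U ->
  exists Lambda : {fset G},
  forall (I : finType) (Omega : I -> {fset G}),
    (forall j k : I, j != k ->
       (Omega j `&` fset_mul Lambda (Omega k))%fset = fset0) ->
  forall x : I -> Z,
  exists z : Z, forall (i : I) (g : G), g \in Omega i ->
    U (act g z, act g (x i)).

Definition is_cover (Z : Type) (alpha : {fset (set Z)}) : Prop :=
  \bigcup_(A in [set` alpha]) A = [set: Z].

Definition open_cover (Z : topologicalType) (alpha : {fset (set Z)}) : Prop :=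
  (forall A, A \in alpha -> open A) /\ is_cover alpha.

(* Minimal cardinality of a subcover; the initial value of the minimum is
   harmless, a cover being a subcover of itself. *)
Definition min_subcover (Z : Type) (alpha : {fset (set Z)}) : nat :=
  \big[minn/#|` alpha|]_(beta <- fpowerset alpha | `[< is_cover beta >])
    #|` beta|.

Definition cover_preim (Z : Type) (f : Z -> Z) (alpha : {fset (set Z)}) :
    {fset (set Z)} := [fset (f @^-1` A)%classic | A in alpha]%fset.

Definition cover_join (Z : Type) (alpha beta : {fset (set Z)}) :
    {fset (set Z)} := [fset (A `&` B)%classic | A in alpha, B in beta]%fset.

Definition cover_iter (G : groupType) (Z : Type) (act : G -> Z -> Z)
    (alpha : {fset (set Z)}) (F : {fset G}) : {fset (set Z)} :=
  \big[@cover_join Z/[fset [set: Z]]%fset]_(g <- F) cover_preim (act g) alpha.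

(* The logarithm is extended by log 0 = -oo, so that the entropy of the empty
   space is -oo (with [ln 0 = 0] it would be that of a point). *)
Definition cover_rate (R : realType) (G : groupType) (Z : Type)
    (act : G -> Z -> Z) (alpha : {fset (set Z)}) (F : {fset G}) : \bar R :=
  (lne ((min_subcover (cover_iter act alpha F))%:R%:E)
     * ((#|` F|)%:R^-1)%:E)%E.

(* The common limit along all left Folner nets. When G is amenable, at most one
   value satisfies the description, and it exists by the Ornstein-Weiss lemma;
   the default value 0 then plays no role. *)
Definition cover_entropy (R : realType) (G : groupType) (Z : Type)
    (act : G -> Z -> Z) (alpha : {fset (set Z)}) : \bar R :=
  xget 0%E [set h : \bar R |
    forall (J : directedSet) (F : J -> {fset G}), left_folner_net R F ->
      (fun j => cover_rate R act alpha (F j)) @ tails J --> h].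

Definition topological_entropy (R : realType) (G : groupType)
    (Z : topologicalType) (act : G -> Z -> Z) : \bar R :=
  ereal_sup [set cover_entropy R act alpha | alpha in @open_cover Z].

(* Main.v *)
(* Write N(alpha, F) for the minimal cardinality of a subcover of the join of
   the g^-1 alpha, g in F.  Since the entropy of a cover is a limit along all
   Folner nets, its existence is needed: this is the Ornstein-Weiss lemma for
   log N(alpha, F), proved by packing translates of a single well chosen set in
   every sufficiently invariant one and bounding what is left over by the limit
   superior.

   Expansiveness gives a cover gamma of Y whose entropy is that of Y.  Fix a
   point x0 outside Y.  In a finite set F choose a subset S of size proportional
   to F whose points are far apart; for every subset J of S, weak specification
   provides points of X that follow x0 at the times in J and a point of Y at
   the times of F away from J.  The set J can be read off from such a point,
   and prescribing J costs at most a factor C^|J| in the choice of the point of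
   Y.  So at least
     sum_J N(gamma, F) / C^|J| = N(gamma, F) (1 + 1/C)^|S|
   points are separated at a scale independent of F, which makes the growth rate
   in X larger than that in Y by a fixed amount. *)
Require Import Defs.
From mathcomp Require Import all_boot all_order all_algebra finmap.
From mathcomp Require Import all_classical all_reals all_analysis.
From mathcomp Require Import ring lra.

Set Implicit Arguments.
Unset Strict Implicit.
Unset Printing Implicit Defensive.

Import Order.TTheory GRing.Theory Num.Theory.
Import numFieldNormedType.Exports.

Local Open Scope classical_set_scope.
Local Open Scope ring_scope.

(** * Almost invariant finite sets *)

Definition fset_rmul (G : groupType) (F : {fset G}) (g : G) : {fset G} :=
  [fset (h * g)%g | h in F]%fset.

Section Translates.
Variable G : groupType.
Implicit Types (A B D F T : {fset G}) (c g h x : G).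

Lemma mem_lmul g F x : (x \in fset_lmul g F) = (g^-1 * x \in F)%g.
Proof.
apply/imfsetP/idP => /= [[y yF ->]|xF]; first by rewrite mulKg.
by exists (g^-1 * x)%g; rewrite // mulVKg.
Qed.

Lemma mem_rmul F c x : (x \in fset_rmul F c) = (x * c^-1 \in F)%g.
Proof.
apply/imfsetP/idP => /= [[y yF ->]|xF]; first by rewrite mulgK.
by exists (x * c^-1)%g; rewrite // mulgVK.
Qed.

Lemma mem_fset_mul A B x :
  reflect (exists g h, [/\ g \in A, h \in B & x = g * h]%g) (x \in fset_mul A B).
Proof.
apply: (iffP (imfset2P _ _ _ _ _)) => /=.
  by move=> [g gA [h hB ->]]; exists g, h.
by move=> [g [h [gA hB ->]]]; exists g => //; exists h.
Qed.

Lemma card_lmul g F : #|` fset_lmul g F| = #|` F|.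
Proof. by rewrite card_imfset //; exact: mulgI. Qed.

Lemma card_rmul F c : #|` fset_rmul F c| = #|` F|.
Proof. by rewrite card_imfset //; exact: mulIg. Qed.

Lemma card_lmulDC g F :
  #|` (fset_lmul g F `\` F)%fset| = #|` (F `\` fset_lmul g F)%fset|.
Proof.
apply/eqP; rewrite -(eqn_add2l #|` (F `&` fset_lmul g F)%fset|) cardfsID.
by rewrite fsetIC cardfsID card_lmul.
Qed.

(** Left and right translations commute, so a right translate is exactly as invariant as the
    original set; this is why packings use right translates. *)
Lemma card_lmul_rmulD g F c :
  #|` (fset_lmul g (fset_rmul F c) `\` fset_rmul F c)%fset| =
  #|` (fset_lmul g F `\` F)%fset|.
Proof.
rewrite -(card_rmul (fset_lmul g F `\` F)%fset c); congr #|` _|.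
by apply/fsetP => x; rewrite !(in_fsetD, mem_lmul, mem_rmul) mulgA.
Qed.

Lemma card_bigfcup_le (s : seq G) (f : G -> {fset G}) :
  (#|` \bigcup_(t <- s) f t|%fset <= \sum_(t <- s) #|` f t|)%N.
Proof.
elim: s => [|t s IH]; first by rewrite !big_nil cardfs0.
by rewrite !big_cons; apply: leq_trans (leq_card_fsetU _ _).1 _; rewrite leq_add.
Qed.

Lemma card_fset_mul_le A B : (#|` fset_mul A B| <= #|` A| * #|` B|)%N.
Proof.
have sub : (fset_mul A B `<=` \bigcup_(a <- A) fset_lmul a B)%fset.
  apply/fsubsetP => x /mem_fset_mul[a [b [aA bE ->]]].
  by apply/bigfcupP; exists a; rewrite ?aA // mem_lmul mulKg.
apply: leq_trans (fsubset_leq_card sub) _.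
apply: leq_trans (card_bigfcup_le _ _) _.
under eq_bigr do rewrite card_lmul.
by rewrite big_const_seq count_predT iter_addn_0 mulnC.
Qed.

Lemma card_fset_mulD_le A B :
  (#|` fset_mul A B `\` B|%fset <= \sum_(a <- A) #|` fset_lmul a B `\` B|%fset)%N.
Proof.
have sub : (fset_mul A B `\` B `<=` \bigcup_(a <- A) (fset_lmul a B `\` B))%fset.
  apply/fsubsetP => x; rewrite in_fsetD => /andP[xB].
  move=> /mem_fset_mul[a [b [aA bE Ex]]].
  apply/bigfcupP; exists a; rewrite ?aA // in_fsetD xB.
  by rewrite Ex mem_lmul mulKg.
exact: leq_trans (fsubset_leq_card sub) (card_bigfcup_le _ _).
Qed.

Lemma sum_mem_card A B :
  (\sum_(x <- B) (x \in A) = #|` (A `&` B)%fset|)%N.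
Proof.
have -> : (\sum_(x <- B) (x \in A) = \sum_(x <- B | x \in A) 1)%N.
  by rewrite [RHS]big_mkcond; apply: eq_bigr => x _; case: (x \in A).
rewrite sum1_count -size_filter; apply: perm_size; apply: uniq_perm.
- by rewrite filter_uniq.
- exact: fset_uniq.
by move=> x; rewrite mem_filter in_fsetI.
Qed.

Lemma sum_mem_rmul T A c :
  (\sum_(t <- T) (t * c \in A)%g = #|` (A `&` fset_rmul T c)%fset|)%N.
Proof.
rewrite -sum_mem_card /fset_rmul big_imfset //=.
by move=> x y _ _; exact: mulIg.
Qed.

Lemma sum_mem_lmul D A t : (\sum_(c <- D) (t * c \in A)%g <= #|` A|)%N.
Proof.
suff -> : (\sum_(c <- D) (t * c \in A)%g =
    #|` (A `&` fset_lmul t D)%fset|)%N by rewrite fsubset_leq_card ?fsubsetIl.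
rewrite -sum_mem_card /fset_lmul big_imfset //=.
by move=> x y _ _; exact: mulgI.
Qed.

(** The left side counts the pairs (t, c) in T x D with t c in A; by cancellation each t admits at
    most |A| of them. *)
Lemma double_count T A D :
  (\sum_(c <- D) #|` (A `&` fset_rmul T c)%fset| <= #|` T| * #|` A|)%N.
Proof.
under eq_bigr do rewrite -sum_mem_rmul.
rewrite exchange_big /= (card_fset_sum1 T) big_distrl /=.
by apply: leq_sum => t _; rewrite mul1n sum_mem_lmul.
Qed.

End Translates.

Global Instance tails_filter (J : directedSet) : ProperFilter (tails J).
Proof.
apply: filter_from_proper; last first.
  by move=> j _; exists j; exact: directed_refl.
apply: filter_from_filter.
  by have [j] := directed_inhabited J; exists j.
move=> i j _ _; have [k [ik jk]] := directed_ub i j; exists k => // l kl.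
by split; apply: directed_trans kl.
Qed.

Section AlmostInvariant.
Variables (R : realType) (G : groupType).
Implicit Types (K F T A : {fset G}) (d e : R).

(** Folner's condition in its (K, d) form, which replaces nets by one finite set at a time. *)
Definition almost_invariant K d F := F != fset0 /\
  forall g, g \in K ->
    #|` (fset_lmul g F `\` F)%fset|%:R <= d * #|` F|%:R.

Lemma almost_invariantW K K' d d' F :
  (K `<=` K')%fset -> d' <= d -> almost_invariant K' d' F ->
  almost_invariant K d F.
Proof.
move=> /fsubsetP KK' dd' [F0 iF]; split => // g /KK' /iF /le_trans; apply.
by rewrite ler_wpM2r.
Qed.

Lemma card_gt0R F : F != fset0 -> 0 < #|` F|%:R :> R.
Proof. by rewrite ltr0n cardfs_gt0. Qed.

Lemma folner_net_almost_invariant (J : directedSet) (F : J -> {fset G}) K d :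
  0 < d -> left_folner_net R F ->
  exists j, forall k, directed_le j k -> almost_invariant K d (F k).
Proof.
move=> d0 [F0 cF].
suff [j Hj] : exists j, forall k, directed_le j k -> forall g, g \in K ->
    #|` (fset_lmul g (F k) `\` F k)%fset|%:R <= d * #|` F k|%:R.
  by exists j => k jk; split => // g gK; exact: Hj.
elim/finSet_rect: K => K IH.
have [->|[g gK]] := fset_0Vmem K.
  by have [j] := directed_inhabited J; exists j.
have /IH[j Hj] : (K `\ g `<` K)%fset by rewrite fproperD1.
have := cF g => /cvgrPdist_le/(_ _ d0)[i _ Hi].
have [k [jk ik]] := directed_ub j i.
exists k => l kl h hK; have [->|hg] := eqVneq h g.
  have /= := Hi l (directed_trans ik kl).
  rewrite sub0r normrN ger0_norm; last by rewrite divr_ge0.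
  by rewrite ler_pdivrMr // card_gt0R.
by apply: (Hj l (directed_trans jk kl)); rewrite in_fsetD1 hg.
Qed.

Lemma amenable_almost_invariant K d :
  amenable R G -> 0 < d -> exists F, almost_invariant K d F.
Proof.
move=> [J [F fF]] d0; have [j Hj] := folner_net_almost_invariant K d0 fF.
by exists (F j); apply: Hj; exact: directed_refl.
Qed.

(** Convergence of [f F] / |F| to [l] as F becomes more and more invariant, with the denominator
    cleared. It gives the limit along all Folner nets at once. *)
Definition folner_limit (f : {fset G} -> R) (l : R) := forall e, 0 < e ->
  exists K d, 0 < d /\ forall F, almost_invariant K d F ->
    (l - e) * #|` F|%:R <= f F <= (l + e) * #|` F|%:R.

(** Amenability supplies a single F invariant enough for all three estimates, which are then
    compared on it. *)
Lemma folner_limit_le (f g : {fset G} -> R) (l m c : R) : amenable R G ->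
  folner_limit f l -> folner_limit g m ->
  (forall e, 0 < e -> exists K d, 0 < d /\ forall F, almost_invariant K d F ->
    f F <= g F + (c + e) * #|` F|%:R) -> l <= m + c.
Proof.
move=> amG fl gm fg; apply/ler_addgt0Pr => e e0.
have e3 : 0 < e / 3 by rewrite divr_gt0.
have [K1 [d1 [d10 H1]]] := fl _ e3.
have [K2 [d2 [d20 H2]]] := gm _ e3.
have [K3 [d3 [d30 H3]]] := fg _ e3.
pose d := Num.min d1 (Num.min d2 d3).
have d0 : 0 < d by rewrite !lt_min d10 d20.
have [F iF] := amenable_almost_invariant (K1 `|` (K2 `|` K3))%fset amG d0.
have /H1/andP[lo _] : almost_invariant K1 d1 F.
  by apply: almost_invariantW iF; rewrite ?fsubsetUl // ge_min lexx.
have /H2/andP[_ hi] : almost_invariant K2 d2 F.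
  apply: almost_invariantW iF; last by rewrite !ge_min lexx orbT.
  by rewrite fsetUCA fsubsetUl.
have /H3 fgF : almost_invariant K3 d3 F.
  apply: almost_invariantW iF; last by rewrite !ge_min lexx !orbT.
  by rewrite fsetUA fsubsetUr.
have F0 := card_gt0R iF.1.
rewrite -(ler_pM2r F0); lra.
Qed.

End AlmostInvariant.

(** * The Ornstein-Weiss lemma *)

Section OrnsteinWeiss.
Variables (R : realType) (G : groupType) (f : {fset G} -> R) (M : R).
Hypothesis f0 : f fset0 = 0.
Hypothesis f_ge0 : forall A, 0 <= f A.
Hypothesis fU : forall A B, f (A `|` B)%fset <= f A + f B.
Hypothesis f_rmul : forall A c, f (fset_rmul A c) = f A.
Hypothesis f_le : forall A, f A <= M * #|` A|%:R.
Implicit Types (K F T A : {fset G}) (d e : R).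

(* A maximal family of k right translates of T inside F, each of which
   overlaps the previous ones in at most the proportion kappa. *)
Lemma maximal_packing T F (kappa : R) : T != fset0 -> 0 < kappa < 1 ->
  exists A k, [/\ (A `<=` F)%fset,
    k%:R * (1 - kappa) * #|` T|%:R <= #|` A|%:R,
    f A <= k%:R * f T,
    forall g, (#|` (fset_lmul g A `\` A)%fset| <=
               k * #|` (fset_lmul g T `\` T)%fset|)%N &
    kappa * #|` [fset c in F | (fset_rmul T c `<=` F)%fset]%fset|%:R
      <= #|` A|%:R].
Proof.
move=> T0 /andP[k0 k1].
pose P A k := [/\ (A `<=` F)%fset,
    k%:R * (1 - kappa) * #|` T|%:R <= #|` A|%:R,
    f A <= k%:R * f T &
    forall g, (#|` (fset_lmul g A `\` A)%fset| <=
               k * #|` (fset_lmul g T `\` T)%fset|)%N].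
have T1 : 1 <= #|` T|%:R :> R by rewrite ler1n cardfs_gt0.
have exP : exists k, `[< exists A, P A k >].
  exists 0%N; apply/asboolP; exists fset0; split.
  - exact: fsub0set.
  - by rewrite !mul0r.
  - by rewrite f0 mul0r.
  - by move=> g; rewrite /fset_lmul imfset0 fset0D cardfs0.
(* As |T| >= 1, the cardinality clause gives k (1 - kappa) <= |F|, so a largest k exists. *)
have [n Hn] : exists n : nat, #|` F|%:R / (1 - kappa) <= n%:R.
  exists (Num.truncn (#|` F|%:R / (1 - kappa))).+1.
  by rewrite ltW // truncnS_gt.
have bP k : `[< exists A, P A k >] -> (k <= n)%N.
  move=> /asboolP[A [AF kA _ _]]; rewrite -(ler_nat R); apply: le_trans Hn.
  rewrite ler_pdivlMr ?subr_gt0 //.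
  apply: (@le_trans _ _ #|` A|%:R); last by rewrite ler_nat fsubset_leq_card.
  apply: le_trans kA; rewrite ler_peMr // mulr_ge0 // subr_ge0 ltW //.
case: (ex_maxnP exP bP) => k /asboolP[A [AF kA fA bA]] maxk.
exists A, k; split => //.
set D := [fset c in F | _]%fset.
(* With a smaller overlap, adding T c to A would give an admissible family of k + 1 translates. *)
have overlap c : c \in D ->
    kappa * #|` T|%:R <= #|` (A `&` fset_rmul T c)%fset|%:R.
  rewrite !inE /= => /andP[cF TcF]; rewrite leNgt; apply/negP => lt_ov.
  suff /maxk : `[< exists A, P A k.+1 >] by rewrite ltnn.
  apply/asboolP; exists (A `|` fset_rmul T c)%fset; split.
  - by rewrite fsubUset AF.
  - have : #|` (A `|` fset_rmul T c)%fset|%:R + #|` (A `&` fset_rmul T c)%fset|%:R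
        = #|` A|%:R + #|` T|%:R :> R by rewrite -!natrD cardfsUI card_rmul.
    rewrite -natr1; nra.
  - apply: le_trans (fU _ _) _; rewrite f_rmul -natr1 mulrDl mul1r.
    by rewrite lerD2r.
  - move=> g; rewrite mulSn addnC.
    apply: leq_trans _ (leq_add (bA g) (eq_leq (card_lmul_rmulD g T c))).
    apply: leq_trans _ (leq_card_fsetU _ _).1.
    apply: fsubset_leq_card; apply/fsubsetP => x.
    rewrite !inE !mem_lmul !inE !negb_or => /andP[/andP[-> ->]].
    by rewrite !andTb.
have := double_count T A D; rewrite -(ler_nat R) natrM natr_sum.
have : \sum_(c <- D) kappa * #|` T|%:R <=
    \sum_(c <- D) #|` (A `&` fset_rmul T c)%fset|%:R :> R.
  rewrite big_seq [X in _ <= X]big_seq; exact: ler_sum.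
rewrite big_const_seq count_predT iter_addr_0 => /le_trans H /H.
rewrite -[X in X <= _ -> _]mulr_natr mulrAC mulrC ler_pM2l //.
by apply: lt_le_trans T1.
Qed.

(** If K c leaves F, then t c is outside F for some t in K, so c lies in t^-1 (t F \ F); each of
    these |K| sets has at most d |F| points. *)
Lemma card_interior K d F : almost_invariant K d F ->
  (1 - #|` K|%:R * d) * #|` F|%:R <=
    #|` [fset c in F | (fset_rmul K c `<=` F)%fset]%fset|%:R.
Proof.
move=> [_ iF]; set D := [fset c in F | _]%fset.
have DF : (D `<=` F)%fset by apply/fsubsetP => x; rewrite !inE => /andP[].
have sub : (F `\` D `<=` \bigcup_(t <- K)
    fset_lmul t^-1 (fset_lmul t F `\` F))%fset.
  apply/fsubsetP => c; rewrite !inE negb_and => /andP[+ cF].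
  rewrite cF /= => /fsubsetPn[x]; rewrite mem_rmul => xK xF.
  apply/bigfcupP; exists (x * c^-1)%g; first by rewrite xK.
  by rewrite mem_lmul in_fsetD invgK mem_lmul mulKg mulgVK xF cF.
have := leq_trans (fsubset_leq_card sub) (card_bigfcup_le _ _).
under eq_bigr do rewrite card_lmul.
have cardDF : (#|` F `\` D|%fset + #|` D| = #|` F|)%N.
  by rewrite cardfsDS // subnK // fsubset_leq_card.
rewrite -(ler_nat R) natr_sum.
have : \sum_(t <- K) #|` (fset_lmul t F `\` F)%fset|%:R <=
   \sum_(t <- K) d * #|` F|%:R :> R.
  rewrite big_seq [X in _ <= X]big_seq; apply: ler_sum => t tK; exact: iF.
rewrite big_const_seq count_predT iter_addr_0 => /[swap] /le_trans /[apply].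
rewrite -[X in _ <= X -> _]mulr_natl -cardDF natrD.
rewrite mulrBl mul1r mulrA; lra.
Qed.

(** A point of g (F \ A) outside F \ A is either outside F or in A \ g A, and the latter set has the
    size of g A \ A. *)
Lemma packing_remainder_boundary g F A : (A `<=` F)%fset ->
  (#|` fset_lmul g (F `\` A) `\` (F `\` A)| <=
   #|` fset_lmul g F `\` F| + #|` fset_lmul g A `\` A|)%fset%N.
Proof.
move=> AF; rewrite (card_lmulDC g A).
apply: leq_trans _ (leq_card_fsetU _ _).1.
apply: fsubset_leq_card; apply/fsubsetP => x.
rewrite !inE !mem_lmul !inE.
by case: (x \in A); case: (x \in F); case: (_ \in A); case: (_ \in F).
Qed.

(** The infimum of these c is the limit superior of [f F] / |F| over increasingly invariant F. *)
Let upper c := exists K d, 0 < d /\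
  forall F, almost_invariant K d F -> f F <= c * #|` F|%:R.

(* One packing step: a set T with f T below (L - e) |T| tiles a definite
   proportion of every sufficiently invariant F, and the remainder is still
   invariant enough for the bound L + eta to hold on it. *)
Lemma upper_improve L e : 0 < e -> e < L -> L <= M ->
  (forall eta, 0 < eta -> upper (L + eta)) ->
  (forall K d, 0 < d -> exists T, almost_invariant K d T /\
     f T <= (L - e) * #|` T|%:R) ->
  exists2 eta, 0 < eta & upper (L - eta).
Proof.
move=> e0 eL LM upL lowL; have L0 : 0 < L by lra.
(* With kappa L = e / 2 one has L - e <= (L - e / 2) (1 - kappa): the overlaps use up at most half
   of the gain e. *)
pose kappa := e / (2 * L).
have kL : kappa * L = e / 2 by rewrite /kappa; field; lra.
have k0 : 0 < kappa by rewrite /kappa divr_gt0 // mulr_gt0.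
have k12 : kappa <= 1 / 2.
  by rewrite /kappa ler_pdivrMr ?mulr_gt0 //; lra.
(* The packed part has at least kappa |F| / 2 points and gains e / 2 on each. That pays for eta (2 +
   M) |F|: one eta for the bound on the remainder, M eta for a small remainder, one eta for the
   conclusion. *)
pose eta := e * kappa / (4 * (2 + M)).
have M2 : 0 < 2 + M by lra.
have M0 : 0 < M by lra.
have eM : eta * (4 * (2 + M)) = e * kappa.
  by rewrite /eta; field; lra.
have eta0 : 0 < eta by apply: divr_gt0; apply: mulr_gt0.
have eta12 : eta <= 1 / 2 by nra.
exists eta => //.
have [K [d [d0 HK]]] := upL _ eta0.
have de0 : 0 < d * eta / 3 by apply: divr_gt0 => //; exact: mulr_gt0.
have [T [iT fT]] := lowL K _ de0.
have T0 := iT.1; have t0 : 0 < #|` T|%:R :> R := card_gt0R R T0.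
(* T is fixed before F, so the tolerance may depend on |T|; then the c with T c inside F fill the
   proportion 1 - eta of F. *)
pose d' := Num.min (d * eta / 3) (eta / #|` T|%:R).
exists (K `|` T)%fset, d'; split.
  by rewrite lt_min de0 divr_gt0.
move=> F iF.
have iFK : almost_invariant K (d * eta / 3) F.
  by apply: almost_invariantW iF; rewrite ?fsubsetUl // ge_min lexx.
have iFT : almost_invariant T (eta / #|` T|%:R) F.
  by apply: almost_invariantW iF; rewrite ?fsubsetUr // ge_min lexx orbT.
have kb : 0 < kappa < 1 by rewrite k0; lra.
have [A [k [AF kA fA bA covA]]] := maximal_packing F T0 kb.
have := card_interior iFT.
rewrite mulrCA divff ?mulr1 ?gt_eqF // => intF.
have cardF : #|` F|%:R = #|` F `\` A|%fset%:R + #|` A|%:R :> R.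
  by rewrite -natrD cardfsDS // subnK // fsubset_leq_card.
have fF : f F <= f A + f (F `\` A)%fset.
  rewrite (le_trans _ (fU _ _)) // fsetUDl fsetDv fsetD0.
  by have /fsetUidPr -> := AF.
set F' := (F `\` A)%fset in cardF fF *.
have n0 : 0 < #|` F|%:R :> R := card_gt0R R iF.1.
have F'0 : 0 <= #|` F'|%:R :> R by [].
(* A remainder of at most eta |F| points is bounded through M. A larger one is still (K,
   d)-invariant: F contributes one third of d eta |F| to its boundary, and the k translates of T the
   other two, since k |T| <= 2 |F|. *)
have fF' : f F' <= (L + eta) * #|` F'|%:R + M * (eta * #|` F|%:R).
  have [F'small|F'big] := leP #|` F'|%:R (eta * #|` F|%:R :> R).
    have := f_le F'; nra.
  suff /HK : almost_invariant K d F'.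
    move=> /le_trans; apply; rewrite lerDl; apply: mulr_ge0;
      [exact: ltW | apply: mulr_ge0; exact: ltW].
  split=> [|g gK].
    rewrite -cardfs_gt0 -(ltr_nat R); apply: le_lt_trans F'big.
    by rewrite mulr_ge0 // ltW.
  have := packing_remainder_boundary g AF; rewrite -(ler_nat R) natrD.
  have := bA g; rewrite -(ler_nat R) natrM.
  have := iT.2 g gK; have := iFK.2 g gK.
  set u := #|` (fset_lmul g F `\` F)%fset|%:R.
  set v := #|` (fset_lmul g T `\` T)%fset|%:R.
  set w := #|` (fset_lmul g A `\` A)%fset|%:R.
  move=> Hu Hv Hw /le_trans; apply.
  have kt : k%:R * #|` T|%:R <= 2 * #|` F|%:R :> R.
    have : k%:R * #|` T|%:R * (1 - kappa) <= #|` A|%:R by rewrite mulrAC.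
    have : 0 <= k%:R * #|` T|%:R :> R by rewrite mulr_ge0.
    by rewrite cardF; nra.
  have : k%:R * v <= k%:R * (d * eta / 3 * #|` T|%:R) by rewrite ler_wpM2l.
  have : d * eta / 3 * (k%:R * #|` T|%:R) <= d * eta / 3 * (2 * #|` F|%:R).
    by rewrite ler_wpM2l // ltW.
  have : d * (eta * #|` F|%:R) <= d * #|` F'|%:R.
    by rewrite ler_wpM2l // ltW.
  nra.
have fA' : f A <= (L - e / 2) * #|` A|%:R.
  have : k%:R * f T <= k%:R * ((L - e) * #|` T|%:R) by rewrite ler_wpM2l.
  have : (L - e) * (k%:R * #|` T|%:R) <=
         (L - e / 2) * (1 - kappa) * (k%:R * #|` T|%:R).
    by rewrite ler_wpM2r ?mulr_ge0 //; nra.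
  have : (L - e / 2) * (k%:R * (1 - kappa) * #|` T|%:R) <=
         (L - e / 2) * #|` A|%:R by rewrite ler_wpM2l //; lra.
  nra.
have An : kappa * ((1 - eta) * #|` F|%:R) <= #|` A|%:R.
  by apply: le_trans covA; rewrite ler_wpM2l // ltW.
have An2 : kappa * ((1 / 2) * #|` F|%:R) <= #|` A|%:R.
  apply: le_trans An; rewrite ler_wpM2l // ?(ltW k0) // ler_wpM2r //; lra.
have eF : eta * (4 * (2 + M)) * #|` F|%:R = e * kappa * #|` F|%:R by rewrite eM.
have : e * (kappa * ((1 / 2) * #|` F|%:R)) <= e * #|` A|%:R.
  by rewrite ler_wpM2l // ltW.
have : 0 <= eta * #|` A|%:R by rewrite mulr_ge0 // ltW.
nra.
Qed.

(** The limit is the infimum L of the eventual upper bounds. If [f T] fell below (L - e) |T| for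
    arbitrarily invariant T, [upper_improve] would produce an upper bound below L. *)
Lemma ornstein_weiss : amenable R G -> exists lambda, folner_limit f lambda.
Proof.
move=> amG.
pose B := [set c | upper c].
have upM : upper M by exists fset0, 1; split => // F _; exact: f_le.
have lbB : lbound B 0.
  move=> c [K [d [d0 HK]]]; have [F iF] := amenable_almost_invariant K amG d0.
  have := le_trans (f_ge0 F) (HK F iF).
  by rewrite pmulr_lge0 // card_gt0R //; exact: iF.1.
have hasB : has_inf B by split; [exists M | exists 0].
pose L := inf B.
have upL eta : 0 < eta -> upper (L + eta).
  move=> eta0; have [c [K [d [d0 HK]]] cL] := inf_adherent eta0 hasB.
  exists K, d; split => // F iF; apply: le_trans (HK F iF) _.
  by rewrite ler_wpM2r // ltW.
exists L => e e0.
suff [K [d [d0 HK]]] : exists K d, 0 < d /\ forall F, almost_invariant K d F ->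
    (L - e) * #|` F|%:R <= f F.
  have [K' [d' [d'0 HK']]] := upL _ e0.
  exists (K `|` K')%fset, (Num.min d d'); split; first by rewrite lt_min d0.
  move=> F iF; rewrite HK ?HK' //.
    by apply: almost_invariantW iF; rewrite ?fsubsetUr // ge_min lexx orbT.
  by apply: almost_invariantW iF; rewrite ?fsubsetUl // ge_min lexx.
apply: contrapT => nlow.
have low K d : 0 < d -> exists T, almost_invariant K d T /\
     f T < (L - e) * #|` T|%:R.
  move=> d0; apply: contrapT => nT; apply: nlow; exists K, d; split => // F iF.
  by rewrite leNgt; apply/negP => lt; apply: nT; exists F.
have eL : e < L.
  have [T [iT fT]] := low fset0 1 ltr01.
  have := le_lt_trans (f_ge0 T) fT.
  by rewrite pmulr_lgt0 ?subr_gt0 // card_gt0R //; exact: iT.1.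
have LM : L <= M by apply: ge_inf => //; exists 0.
have low' K d : 0 < d -> exists T, almost_invariant K d T /\
    f T <= (L - e) * #|` T|%:R.
  by move=> /(low K)[T [iT /ltW fT]]; exists T.
have [eta eta0 upLe] := upper_improve e0 eL LM upL low'.
have : L <= L - eta by apply: ge_inf => //; exists 0.
by rewrite lerBrDr gerDl leNgt eta0.
Qed.

End OrnsteinWeiss.

(** * Covering numbers *)

Section MinSubcover.
Variable Z : Type.
Implicit Types alpha beta : {fset (set Z)}.

Lemma is_coverP alpha :
  is_cover alpha <-> forall z, exists2 A, A \in alpha & A z.
Proof.
split=> [cA z|cA]; first by have : [set: Z] z by []; rewrite -cA.
by apply/seteqP; split => // z _; have [A AA Az] := cA z; exists A.
Qed.

Lemma min_subcover_le alpha beta : is_cover beta -> (beta `<=` alpha)%fset ->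
  (min_subcover alpha <= #|` beta|)%N.
Proof.
move=> cb; rewrite -fpowersetE /min_subcover; move: #|` alpha| => n.
rewrite -[_ \in _]/(_ \in (fpowerset alpha : seq _)).
elim: (fpowerset alpha : seq _) => // b s IH; rewrite inE big_cons.
case/orP => [/eqP <-|/IH bs]; first by case: asboolP => // _; rewrite geq_minl.
by case: ifP => // _; exact: leq_trans (geq_minr _ _) bs.
Qed.

Lemma min_subcover_attained alpha : is_cover alpha -> exists beta,
  [/\ (beta `<=` alpha)%fset, is_cover beta & #|` beta| = min_subcover alpha].
Proof.
move=> ca; rewrite /min_subcover.
have : {subset (fpowerset alpha : seq _) <= fpowerset alpha} by [].
elim: (fpowerset alpha : seq _) => [|b s IH] sub.
  by rewrite big_nil; exists alpha.
have [|b' [b'a cb' Eb']] := IH; first by move=> x xs; rewrite sub // inE xs orbT.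
rewrite big_cons; case: asboolP => [cb|_]; last by exists b'.
have [le|le] := leqP #|` b|
  (\big[minn/#|` alpha|]_(j <- s | `[< is_cover j >]) #|` j|).
  by exists b; rewrite -fpowersetE sub ?mem_head.
by exists b'.
Qed.

End MinSubcover.

Section CoverNumber.
Variables (G : groupType) (Z : Type) (act : G -> Z -> Z).
Implicit Types (alpha beta : {fset (set Z)}) (E F K : {fset G}).

(** A subcover of the iterated join, recorded by itineraries: [phi i g] is the member of [alpha]
    visited at time g. Values of [phi i] outside F are free, and repetitions are allowed. *)
Definition itinerary_cover alpha F (I : finType) (phi : I -> G -> set Z) :=
  (forall i g, g \in F -> phi i g \in alpha) /\
  (forall z, exists i, forall g, g \in F -> phi i g (act g z)).

Definition cover_num alpha F := min_subcover (cover_iter act alpha F).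

Lemma cover_iterP alpha F B :
  B \in cover_iter act alpha F <->
  exists2 phi : G -> set Z, forall g, g \in F -> phi g \in alpha &
    B = [set z | forall g, g \in F -> phi g (act g z)].
Proof.
rewrite /cover_iter.
(* Without repetitions in the list, a choice at its head and an itinerary along its tail glue
   together. *)
suff H (s : seq G) : uniq s ->
  (B \in \big[@cover_join Z/[fset [set: Z]]%fset]_(g <- s)
      cover_preim (act g) alpha <->
  exists2 phi : G -> set Z, forall g, g \in s -> phi g \in alpha &
    B = [set z | forall g, g \in s -> phi g (act g z)]).
  exact: (H _ (fset_uniq F)).
elim: s B => [|h s IH] B /=.
  move=> _; rewrite big_nil inE; split=> [/eqP ->|[phi _ ->]].
    exists (fun=> setT) => //; apply/seteqP; split => //.
  by apply/eqP/seteqP; split.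
move=> /andP[hs us]; rewrite big_cons; split.
  move=> /imfset2P[/= A' /imfsetP[/= A Aa ->] [C] /(IH C us)[phi phia ->] ->].
  exists (fun g => if g == h then A else phi g).
    by move=> g; rewrite inE; case: eqVneq => //= _ gs; exact: phia.
  apply/seteqP; split=> z /=.
    move=> [Az phiz] g; rewrite inE; case: eqVneq => [->|_] //=; exact: phiz.
  move=> Hz; split; first by have := Hz h; rewrite mem_head eqxx; exact.
  move=> g gs; have := Hz g; rewrite inE gs orbT.
  by case: eqVneq => [gh|_]; [rewrite -gh gs in hs | exact].
move=> [phi phia ->]; apply/imfset2P => /=.
exists (act h @^-1` phi h).
  by apply/imfsetP; exists (phi h) => //; apply: phia; rewrite mem_head.
exists [set z | forall g, g \in s -> phi g (act g z)].
  by apply/(IH _ us); exists phi => // g gs; apply: phia; rewrite inE gs orbT.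
apply/seteqP; split=> z /=.
  by move=> Hz; split=> [|g gs]; apply: Hz; rewrite inE ?eqxx ?gs ?orbT.
by move=> [Hh Hs] g; rewrite inE => /orP[/eqP ->|/Hs].
Qed.

Lemma cover_num_le alpha F (I : finType) (phi : I -> G -> set Z) :
  itinerary_cover alpha F phi -> (cover_num alpha F <= #|I|)%N.
Proof.
move=> [phia cov].
pose B i := [set z | forall g, g \in F -> phi i g (act g z)].
apply: leq_trans (min_subcover_le (beta := [fset x in codom B]%fset) _ _) _.
- apply/is_coverP => z; have [i Hi] := cov z.
  by exists (B i) => //; rewrite inE /= codom_f.
- apply/fsubsetP => x; rewrite inE /= => /codomP[i ->].
  by apply/cover_iterP; exists (phi i) => // g; exact: phia.
by rewrite card_fseq (leq_trans (size_undup _)) // size_codom.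
Qed.

Lemma cover_iter_cover alpha F : is_cover alpha ->
  is_cover (cover_iter act alpha F).
Proof.
move=> /is_coverP ca; apply/is_coverP => z.
have /choice[phi Hphi] g : exists A, A \in alpha /\ A (act g z).
  by have [A] := ca (act g z); exists A.
exists [set y | forall g, g \in F -> phi g (act g y)].
  by apply/cover_iterP; exists phi => // g _; exact: (Hphi g).1.
by move=> g _; exact: (Hphi g).2.
Qed.

Lemma cover_num_attained alpha F : is_cover alpha ->
  exists (I : finType) (phi : I -> G -> set Z),
    itinerary_cover alpha F phi /\ #|I| = cover_num alpha F.
Proof.
move=> ca; have [beta [ba /is_coverP cb Eb]] :=
  min_subcover_attained (cover_iter_cover F ca).
have /choice[phi Hphi] (b : beta) : exists p : G -> set Z,
    (forall g, g \in F -> p g \in alpha) /\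
    val b = [set z | forall g, g \in F -> p g (act g z)].
  have /cover_iterP[p pa Ep] := fsubsetP ba _ (valP b).
  by exists p.
exists beta, phi; split; last by rewrite -cardfE.
split=> [b g|z]; first exact: (Hphi b).1.
have [b bb bz] := cb z; exists [` bb]%fset.
suff : val [` bb]%fset z by rewrite (Hphi [` bb]%fset).2.
by [].
Qed.

Lemma cover_num_gt0 alpha F : is_cover alpha -> Z -> (0 < cover_num alpha F)%N.
Proof.
move=> ca z; have [I [phi [[_ cov] <-]]] := cover_num_attained F ca.
by have [i _] := cov z; apply/card_gt0P; exists i.
Qed.

(** Not an equality, since the number is 0 for empty Z. *)
Lemma cover_num0 alpha : (cover_num alpha fset0 <= 1)%N.
Proof.
rewrite -card_unit; apply: (@cover_num_le _ _ _ (fun _ _ => setT)).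
by split=> // z; exists tt.
Qed.

Lemma cover_numS alpha E F : is_cover alpha -> (E `<=` F)%fset ->
  (cover_num alpha E <= cover_num alpha F)%N.
Proof.
move=> ca /fsubsetP EF; have [I [phi [[phia cov] <-]]] := cover_num_attained F ca.
apply: (@cover_num_le _ _ _ phi); split=> [i g /EF|z]; first exact: phia.
by have [i Hi] := cov z; exists i => g /EF; exact: Hi.
Qed.

Lemma cover_numU alpha E F : is_cover alpha ->
  (cover_num alpha (E `|` F)%fset <= cover_num alpha E * cover_num alpha F)%N.
Proof.
move=> ca; have [I [phi [[phia covI] <-]]] := cover_num_attained E ca.
have [J [psi [[psia covJ] <-]]] := cover_num_attained F ca.
rewrite -card_prod.
apply: (@cover_num_le _ _ _
  (fun ij g => if g \in E then phi ij.1 g else psi ij.2 g)).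
split=> [[i j] g|z].
  by rewrite inE /=; case: ifP => gE /=; [move=> _; exact: phia | exact: psia].
have [i Hi] := covI z; have [j Hj] := covJ z; exists (i, j) => g.
by rewrite inE /=; case: ifP => gE /=; [move=> _; exact: Hi | exact: Hj].
Qed.

Lemma cover_num1 alpha g : is_cover alpha ->
  (cover_num alpha [fset g]%fset <= #|` alpha|)%N.
Proof.
move=> /is_coverP ca; rewrite cardfE.
apply: (@cover_num_le _ _ _ (fun (A : alpha) _ => val A)); split=> [i h _|z].
  exact: valP.
have [A Aa Az] := ca (act g z).
by exists [` Aa]%fset => h; rewrite inE => /eqP ->.
Qed.

Lemma cover_num_exp alpha F : is_cover alpha ->
  (cover_num alpha F <= #|` alpha| ^ #|` F|)%N.
Proof.
move=> ca; elim/fset1U_rect: F => [|g F gF IH].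
  by rewrite cardfs0 expn0 cover_num0.
rewrite cardfsU1 gF expnS; apply: leq_trans (cover_numU _ _ ca) _.
by rewrite leq_mul // cover_num1.
Qed.

(** Pigeonhole: two points that share an itinerary of an optimal subcover are not separated. *)
Lemma card_separated_le (I : finType) (x : I -> Z) beta F : is_cover beta ->
  (forall i j, i != j -> exists2 g, g \in F &
    forall A, A \in beta -> A (act g (x i)) -> ~ A (act g (x j))) ->
  (#|I| <= cover_num beta F)%N.
Proof.
move=> cb sep; have [J [phi [[phib cov] <-]]] := cover_num_attained F cb.
have /choice[c Hc] i : exists j, forall g, g \in F -> phi j g (act g (x i)).
  exact: cov.
apply: (@leq_card _ _ c) => i j cij; apply/eqP/negP => /negP /sep[g gF].
by move=> /(_ _ (phib (c i) g gF) (Hc i g gF)); apply; rewrite cij; exact: Hc.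
Qed.

Hypothesis actM : forall g h z, act (g * h)%g z = act g (act h z).

(** The itinerary of z along F c is that of c z along F. *)
Lemma cover_num_rmul_le alpha F c : is_cover alpha ->
  (cover_num alpha (fset_rmul F c) <= cover_num alpha F)%N.
Proof.
move=> ca; have [I [phi [[phia cov] <-]]] := cover_num_attained F ca.
apply: (@cover_num_le _ _ _ (fun i g => phi i (g * c^-1)%g)).
split=> [i g|z]; first by rewrite mem_rmul; exact: phia.
have [i Hi] := cov (act c z); exists i => g; rewrite mem_rmul => gF.
by have := Hi _ gF; rewrite -actM mulgVK.
Qed.

Lemma cover_num_rmul alpha F c : is_cover alpha ->
  cover_num alpha (fset_rmul F c) = cover_num alpha F.
Proof.
move=> ca; apply/eqP; rewrite eqn_leq cover_num_rmul_le //=.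
suff {1}-> : F = fset_rmul (fset_rmul F c) c^-1%g by exact: cover_num_rmul_le.
by apply/fsetP => x; rewrite !mem_rmul invgK mulgK.
Qed.

(** The hypothesis says that the join of [gamma] over K refines [alpha]. An itinerary along K F
    restricts to K g for each g in F, and so determines a member of [alpha] at time g. *)
Lemma cover_num_refine alpha gamma F K : is_cover gamma ->
  (forall phi : G -> set Z, (forall k, k \in K -> phi k \in gamma) ->
    exists2 A, A \in alpha &
      [set z | forall k, k \in K -> phi k (act k z)] `<=` A) ->
  (cover_num alpha F <= cover_num gamma (fset_mul K F))%N.
Proof.
move=> cg ref.
have [I [phi [[phig cov] <-]]] := cover_num_attained (fset_mul K F) cg.
have /choice[psi Hpsi] (ig : I * G) : exists A, ig.2 \in F -> A \in alpha /\
    [set z | forall k, k \in K -> phi ig.1 (k * ig.2)%g (act k z)] `<=` A.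
  case: (boolP (ig.2 \in F)) => [gF|_]; last by exists set0.
  have [k kK|A Aa sA] := ref (fun k => phi ig.1 (k * ig.2)%g).
    by apply: phig; apply/mem_fset_mul; exists k, ig.2.
  by exists A.
apply: (@cover_num_le _ _ _ (fun i g => psi (i, g))).
split=> [i g gF|z]; first exact: (Hpsi (i, g) gF).1.
have [i Hi] := cov z; exists i => g gF; apply: (Hpsi (i, g) gF).2 => k kK /=.
by rewrite -actM; apply: Hi; apply/mem_fset_mul; exists k, g.
Qed.

End CoverNumber.

(** * Entropy of a cover as a limit over almost invariant sets *)

Section CoverEntropy.
Variables (R : realType) (G : groupType) (Z : Type) (act : G -> Z -> Z).
Hypothesis actM : forall g h z, act (g * h)%g z = act g (act h z).
Hypothesis amG : amenable R G.
Implicit Types (alpha beta : {fset (set Z)}) (E F K : {fset G}) (d e : R).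

(** Amenability provides a net, along which limits in the extended reals are unique. *)
Lemma cover_entropy_eq alpha (h : \bar R) :
  (forall (J : directedSet) (F : J -> {fset G}), left_folner_net R F ->
      (fun j => cover_rate R act alpha (F j)) @ tails J --> h) ->
  cover_entropy R act alpha = h.
Proof.
move=> ch; rewrite /cover_entropy; case: xgetP => [h' _ ch'|/(_ h)]; last by [].
have [J [F fF]] := amG.
by apply: (@cvg_unique _ (@ereal_hausdorff R) _ _ _ _ (ch' J F fF) (ch J F fF)).
Qed.

Definition cover_log alpha F : R := ln (cover_num act alpha F)%:R.

Lemma cover_rateE alpha F : (0 < cover_num act alpha F)%N ->
  cover_rate R act alpha F = (cover_log alpha F / #|` F|%:R)%:E.
Proof. by move=> n0; rewrite /cover_rate lne_EFin ?ltr0n. Qed.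

Lemma ler_ln_nat m n : (0 < m)%N -> (m <= n)%N -> ln m%:R <= ln n%:R :> R.
Proof.
by move=> m0 mn; rewrite ler_ln ?posrE ?ltr0n ?ler_nat // (leq_trans m0).
Qed.

(** The Ornstein-Weiss lemma for log N with M = log |alpha|. A point of Z makes N positive, so that
    the real logarithm agrees with the extended one. *)
Lemma cover_entropy_lim alpha : is_cover alpha -> Z ->
  exists2 lambda : R, cover_entropy R act alpha = lambda%:E &
    folner_limit (cover_log alpha) lambda.
Proof.
move=> ca z.
have num0 F : (0 < cover_num act alpha F)%N by exact: cover_num_gt0.
have numR F : 0 < (cover_num act alpha F)%:R :> R by rewrite ltr0n.
have [|F|E F|F c|F|lambda Hl] := @ornstein_weiss R G (cover_log alpha)
  (ln #|` alpha|%:R) _ _ _ _ _ amG.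
- rewrite /cover_log (_ : cover_num _ _ _ = 1%N) ?ln1 //.
  by apply/eqP; rewrite eqn_leq cover_num0 num0.
- by rewrite /cover_log ln_ge0 // ler1n.
- rewrite /cover_log -lnM ?posrE // -natrM ler_ln_nat // ?cover_numU //.
- by rewrite /cover_log cover_num_rmul.
- have a0 : (0 < #|` alpha|)%N.
    by have := num0 [fset 1%g]%fset; move=> /leq_trans; apply; exact: cover_num1.
  rewrite /cover_log mulr_natr -lnXn ?ltr0n // -natrX ler_ln_nat //.
  exact: cover_num_exp.
exists lambda => //; apply: cover_entropy_eq => J F fF.
rewrite (_ : (fun j => _) =
  EFin \o (fun j => cover_log alpha (F j) / #|` F j|%:R)).
  apply: cvg_EFin; first by near=> j.
  apply/cvgrPdist_le => /= e e0; have [K [d [d0 HK]]] := Hl e e0.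
  have [j Hj] := folner_net_almost_invariant K d0 fF.
  exists j => // k /= /Hj iF; have /andP[lo hi] := HK _ iF.
  have F0 := card_gt0R R iF.1.
  rewrite distrC ler_distl; rewrite ler_pdivlMr // ler_pdivrMr //.
  by rewrite lo hi.
by apply/funext => j /=; rewrite cover_rateE.
Unshelve. all: by end_near. Qed.

End CoverEntropy.

(** * Compact Hausdorff spaces *)

Section CompactHausdorff.
Variable Z : topologicalType.
Implicit Types (U V : set (Z * Z)).

(** Near-covering compactness, applied to the filter of finite sets ordered by inclusion. *)
Lemma compact_finite_subcover (T : topologicalType) (C : set T)
    (O : T -> set T) : compact C -> (forall z, C z -> nbhs z (O z)) ->
  exists D : {fset T}, forall z, C z -> exists2 t, t \in D & C t /\ O t z.
Proof.
move=> /compact_near_coveringP cC nO.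
pose F : set_system {fset T} :=
  filter_from setT (fun D => [set E | (D `<=` E)%fset]).
have FF : Filter F.
  apply: filter_from_filter; first by exists fset0.
  move=> D E _ _; exists (D `|` E)%fset => // A /=.
  by rewrite fsubUset => /andP[].
pose P (D : {fset T}) z := exists2 t, t \in D & C t /\ O t z.
have [z Cz|D _ HD] := cC _ F P FF.
  exists (O z, [set E : {fset T} | ([fset z] `<=` E)%fset]) => /=.
    by split; [exact: nO | exists [fset z]%fset].
  by move=> [y E] /= [Oy]; rewrite fsub1set => zE; exists z.
by exists D => z Cz; exact: (HD D (fsubset_refl D) z Cz).
Qed.

Lemma compact_entourage_nbhs V : compact_entourage V ->
  forall z : Z, exists2 O, nbhs z O & forall x y, O x -> O y -> V (x, y).
Proof.
move=> entV z; have [[A B] /= [nA nB] AB] := entV (z, z) erefl.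
exists (A `&` B); first exact: filterI.
by move=> x y [Ax _] [_ By]; exact: AB.
Qed.

(** The building block of the entourages below, which are finite intersections of such sets. *)
Lemma compact_entourage_imply (C O : set Z) :
  closed C -> C `<=` interior O -> compact_entourage [set p | C p.1 -> O p.2].
Proof.
move=> clC CO [a b] ab; have {b ab}<- : a = b := ab.
have [Ca|nCa] := pselect (C a).
  exists (setT, O) => /=; first by split; [exact: filterT | exact: CO].
  by move=> p [_ Op] _.
exists (~` C, setT) => /=; last by move=> p [nC _] /nC.
split; last exact: filterT.
by apply: open_nbhs_nbhs; split => //; exact: closed_openC.
Qed.

Lemma compact_entourage_bigcap (I : choiceType) (D : {fset I})
    (V : I -> set (Z * Z)) : (forall i, compact_entourage (V i)) ->
  compact_entourage (\bigcap_(i in [set` D]) V i).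
Proof. by move=> entV p Dp; apply: filter_bigI => i _; exact: entV. Qed.

Hypothesis cptZ : compact [set: Z].
Hypothesis t2Z : hausdorff_space Z.

Lemma compact_closed_nbhs (z : Z) (O : set Z) : nbhs z O ->
  exists2 P, nbhs z P & closure P `<=` interior O.
Proof.
move=> /nbhs_interior nO.
by apply: (compact_regular t2Z cptZ) => //; exact: filterT.
Qed.

Lemma open_cover_nbhs (O : Z -> set Z) : (forall z, nbhs z (O z)) ->
  exists D : {fset Z}, open_cover [fset interior (O t) | t in D]%fset.
Proof.
move=> nO.
have [|D HD] := @compact_finite_subcover _ _ (fun z => interior (O z)) cptZ.
  by move=> z _; exact: nbhs_interior.
exists D; split.
  by move=> A /imfsetP[t _ ->]; exact: open_interior.
apply/is_coverP => z; have [//|t tD [_ Oz]] := HD z.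
by exists (interior (O t)) => //; apply/imfsetP; exists t.
Qed.

Lemma entourage_open_cover V : compact_entourage V ->
  exists2 beta : {fset (set Z)}, open_cover beta &
    forall A, A \in beta -> forall x y, A x -> A y -> V (x, y).
Proof.
move=> /compact_entourage_nbhs H.
have /choice[N HN] (z : Z) :
  exists N, nbhs z N /\ forall x y, N x -> N y -> V (x, y).
  by have [N] := H z; exists N.
have [D cD] := open_cover_nbhs (fun z => (HN z).1).
exists [fset interior (N t) | t in D]%fset => // A /imfsetP[t _ ->] x y Nx Ny.
by apply: (HN t).2; exact: interior_subset.
Qed.

(** The Lebesgue number lemma. Shrunken sets P t still cover, and V sends each closure of P t into A
    t. *)
Lemma lebesgue_entourage (alpha : {fset (set Z)}) : open_cover alpha ->
  exists2 V, compact_entourage V &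
    forall z, exists2 A, A \in alpha & forall y, V (z, y) -> A y.
Proof.
move=> [oa /is_coverP ca].
have /choice[A HA] (z : Z) : exists A, A \in alpha /\ A z.
  by have [A] := ca z; exists A.
have nA (z : Z) : nbhs z (A z).
  by apply: open_nbhs_nbhs; split; [apply: oa|]; case: (HA z).
have /choice[P HP] (z : Z) : exists P, nbhs z P /\ closure P `<=` interior (A z).
  by have [P] := compact_closed_nbhs (nA z); exists P.
have [|D HD] := @compact_finite_subcover _ _ P cptZ.
  by move=> z _; exact: (HP z).1.
exists (\bigcap_(t in [set` D]) [set p | closure (P t) p.1 -> A t p.2]).
  apply: compact_entourage_bigcap => t; apply: compact_entourage_imply.
    exact: closed_closure.
  exact: (HP t).2.
move=> z; have [//|t tD [_ Pz]] := HD z; exists (A t); first exact: (HA t).1.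
by move=> y /(_ t tD); apply; exact: subset_closure.
Qed.

(* With nested neighbourhoods P t, Q t, N t of the points t of a finite set,
   one step of U leads from P t into Q t and from Q t into N t. *)
Lemma entourage_split3 V : compact_entourage V ->
  exists2 U, compact_entourage U & forall z z' y y',
    U (z, y) -> U (z', y') -> U (z, z') -> V (y, y').
Proof.
move=> /compact_entourage_nbhs H.
have /choice[N HN] (z : Z) :
  exists N, nbhs z N /\ forall x y, N x -> N y -> V (x, y).
  by have [N] := H z; exists N.
have /choice[Q HQ] (z : Z) : exists Q, nbhs z Q /\ closure Q `<=` interior (N z).
  by have [Q] := compact_closed_nbhs (HN z).1; exists Q.
have /choice[P HP] (z : Z) : exists P, nbhs z P /\ closure P `<=` interior (Q z).
  by have [P] := compact_closed_nbhs (HQ z).1; exists P.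
have [|D HD] := @compact_finite_subcover _ _ P cptZ.
  by move=> z _; exact: (HP z).1.
exists (\bigcap_(t in [set` D]) ([set p | closure (P t) p.1 -> Q t p.2] `&`
                                 [set p | closure (Q t) p.1 -> N t p.2])).
  apply: compact_entourage_bigcap => t p dp; apply: filterI; move: p dp;
  apply: compact_entourage_imply; try exact: closed_closure.
  - exact: (HP t).2.
  - exact: (HQ t).2.
move=> z z' y y' zy zy' zz'; have [//|t tD [_ Pz]] := HD z.
have [zyP _] := zy t tD; have [_ zyQ] := zy' t tD; have [zzP _] := zz' t tD.
have Pz' := subset_closure Pz.
apply: (HN t).2; last by apply: zyQ; apply: subset_closure; exact: zzP.
apply: interior_subset; apply: (HQ t).2; apply: subset_closure; exact: zyP.
Qed.

Variables (G : groupType) (act : G -> Z -> Z).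
Hypothesis act_cont : forall g, continuous (act g).

(** Expansiveness and compactness make the cells of a finite join of [gamma] smaller than a Lebesgue
    entourage of [alpha]; K collects the finitely many separating elements. *)
Lemma expansive_generator (z0 : Z) : expansive act ->
  exists2 gamma : {fset (set Z)}, open_cover gamma &
  forall alpha : {fset (set Z)}, open_cover alpha ->
  exists K : {fset G}, forall phi : G -> set Z,
    (forall k, k \in K -> phi k \in gamma) ->
    exists2 A, A \in alpha &
      [set z | forall k, k \in K -> phi k (act k z)] `<=` A.
Proof.
move=> [U0 /compact_entourage_nbhs H sep].
have /choice[N HN] (z : Z) :
  exists N, nbhs z N /\ forall x y, N x -> N y -> U0 (x, y).
  by have [N] := H z; exists N.
have /choice[P HP] (z : Z) : exists P, nbhs z P /\ closure P `<=` interior (N z).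
  by have [P] := compact_closed_nbhs (HN z).1; exists P.
have [D cD] := open_cover_nbhs (fun z => (HP z).1).
exists [fset interior (P t) | t in D]%fset => // alpha oca.
have [L entL HL] := lebesgue_entourage oca.
pose C := ~` interior L.
have cC : compact C.
  apply: (@subclosed_compact _ _ setT) => //.
    by apply: open_closedC; exact: open_interior.
  by rewrite -setXTT; exact: compact_setX.
have /choice[g Hg] (p : Z * Z) : exists g, C p -> ~ U0 (act g p.1, act g p.2).
  have [Cp|] := pselect (C p); last by exists 1%g.
  have [|g Hg] := sep p.1 p.2; last by exists g.
  by move=> p12; apply: Cp; exact: entL.
(* The pairs whose images under [g p] share no closure of a P t. This is a neighbourhood of p,
   because [g p] moves p out of U0 while pairs inside one N t stay in U0. *)
pose S (p : Z * Z) : set (Z * Z) := \bigcap_(t in [set` D])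
  [set q | ~ (closure (P t) (act (g p) q.1) /\ closure (P t) (act (g p) q.2))].
have [|D' HD'] := @compact_finite_subcover _ C S cC.
  move=> p Cp; apply: filter_bigI => t _ /=.
  have clN x : ~ closure (P t) (act (g p) x) ->
      nbhs x [set y | ~ closure (P t) (act (g p) y)].
    move=> nx; apply: (@act_cont (g p) x (~` closure (P t))).
    apply: open_nbhs_nbhs; split => //.
    by apply: closed_openC; exact: closed_closure.
  have [c1|/clN n1] := pselect (closure (P t) (act (g p) p.1)).
    have [c2|/clN n2] := pselect (closure (P t) (act (g p) p.2)).
      by exfalso; apply: (Hg p Cp); apply: (HN t).2; apply: interior_subset;
        apply: (HP t).2.
    exists (setT, [set y | ~ closure (P t) (act (g p) y)]) => /=.
      by split; first exact: filterT.
    by move=> q [_ n2'] [_ /n2'].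
  exists ([set y | ~ closure (P t) (act (g p) y)], setT) => /=.
    by split; last exact: filterT.
  by move=> q [n1' _] [/n1'].
exists [fset g p | p in D']%fset => phi phig.
set B := [set z | _].
(* An empty cell lies in any member of [alpha]; z0 provides one. *)
have [[z Bz]|nB] := pselect (exists z, B z); last first.
  have [A Aa _] := HL z0; exists A => // z Bz.
  by exfalso; apply: nB; exists z.
have [A Aa zA] := HL z; exists A => // y By; apply: zA; apply: contrapT => nL.
have [|p pD' [_ Sp]] := HD' (z, y); first by move=> /interior_subset.
have gK : g p \in [fset g p | p in D']%fset by apply/imfsetP; exists p.
have /imfsetP[t /= tD Et] := phig _ gK.
apply: (Sp t tD); split; apply: subset_closure; apply: interior_subset.
  by rewrite -Et; exact: Bz.
by rewrite -Et; exact: By.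
Qed.

End CompactHausdorff.

(** * Closed subspaces and the restricted action *)

Section ClosedSubspace.
Variables (X : topologicalType) (Y : set X).

Lemma nbhs_set_val (y : Y) (V : set Y) : nbhs y V <->
  exists2 N, nbhs (set_val y) N & forall y' : Y, N (set_val y') -> V y'.
Proof.
split=> [[_ [[N oO <-] Oy] OV]|[N nO OV]].
  by exists N => [|y' Oy']; [exact: open_nbhs_nbhs | exact: OV].
apply: filterS OV _; exact: (@initial_continuous _ _ set_val y).
Qed.

Lemma set_type_compact : compact [set: X] -> closed Y -> compact [set: Y].
Proof.
move=> cX clY.
have /compact_near_coveringP cY : compact Y.
  exact: (subclosed_compact clY cX).
apply/compact_near_coveringP => I F P FF HP.
pose P' i x := forall y : Y, set_val y = x -> P i y.
suff /(cY I F P' FF) : forall x, Y x -> \near x & F, P' F x.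
  by apply: filterS => i Hi y _; apply: (Hi (set_val y)) => //; exact: set_valP.
move=> x Yx; have [[A B] /= [nA FB] AB] := HP (exist _ x (mem_set Yx)) Logic.I.
have /nbhs_set_val[N nN NA] := nA.
exists (N, B) => //= -[x' i] /= [Nx' Bi] y yx'; apply: (AB (y, i)); split => //=.
by apply: NA; rewrite yx'.
Qed.

Lemma set_type_hausdorff : hausdorff_space X -> hausdorff_space Y.
Proof.
move=> t2 p q clpq; apply: val_inj; apply: t2 => A B nA nB.
have [||y [Ay By]] := clpq (set_val @^-1` A) (set_val @^-1` B).
- by apply/nbhs_set_val; exists A.
- by apply/nbhs_set_val; exists B.
by exists (set_val y).
Qed.

(* The second clause cuts off the point x0, so that one entourage of X serves
   both to separate the orbits in Y and to recognize visits near x0. *)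
Lemma entourage_extension (V : set (Y * Y)) (x0 : X) :
  hausdorff_space X -> closed Y -> ~ Y x0 -> compact_entourage V ->
  exists2 V' : set (X * X), compact_entourage V' &
    (forall y y' : Y, V' (set_val y, set_val y') -> V (y, y')) /\
    (forall y : Y, ~ V' (set_val y, x0)).
Proof.
move=> t2 clY Yx0 entV.
exists ([set p | forall y y' : Y, set_val y = p.1 -> set_val y' = p.2 -> V (y, y')]
   `&` [set p | Y p.1 -> p.2 <> x0]).
  move=> [a b] ab; have {b ab}<- : a = b := ab.
  have [Ya|nYa] := pselect (Y a); last first.
    have nY : nbhs a (~` Y).
      by apply: open_nbhs_nbhs; split => //; exact: closed_openC.
    exists (~` Y, ~` Y) => //= -[c d] /= [nc _]; split => [y y' yc|//].
    by exfalso; apply: nc; rewrite -yc; exact: set_valP.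
  have [N nO OV] := compact_entourage_nbhs entV (exist _ a (mem_set Ya)).
  have /nbhs_set_val[N' nO' N'N] := nO.
  have nx0 : nbhs a (~` [set x0]).
    apply: open_nbhs_nbhs; split; last by move=> ax0; apply: Yx0; rewrite -ax0.
    apply: closed_openC; exact: accessible_closed_set1 (hausdorff_accessible t2) _.
  exists (N', N' `&` ~` [set x0]) => /=; first by split => //; exact: filterI.
  move=> [c d] /= [Oc [Od dx0]]; split=> [y y' yc yd|_ //].
  by apply: OV; apply: N'N; rewrite ?yc ?yd.
split=> [y y' [VV _]|y [_ ny]]; first exact: VV.
by apply: ny => //=; exact: set_valP.
Qed.

Variables (G : groupType) (act : G -> X -> X) (invY : invariant_set act Y).

Lemma restricted_actionM :
  (forall g h x, act (g * h)%g x = act g (act h x)) ->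
  forall g h y, restricted_action invY (g * h)%g y =
    restricted_action invY g (restricted_action invY h y).
Proof. by move=> actM g h y; apply: val_inj; exact: actM. Qed.

Lemma restricted_action_continuous g : continuous (act g) ->
  continuous (restricted_action invY g).
Proof.
move=> cg y V /nbhs_set_val[N nO OV]; apply/nbhs_set_val.
exists (act g @^-1` N); first exact: cg.
by move=> y' Oy'; exact: OV.
Qed.

End ClosedSubspace.

(** * The entropy gap *)

Section Counting.
Variable G : groupType.
Implicit Types (A E F K L S : {fset G}).

(** Greedy choice: a point of F joins S unless L S already contains it. Symmetry of L makes the
    separation symmetric. *)
Lemma maximal_separated L F : 1%g \in L -> (forall g, g \in L -> g^-1%g \in L) ->
  exists S, [/\ (S `<=` F)%fset,
    forall c c', c \in S -> c' \in S -> c != c' -> (c * c'^-1)%g \notin L &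
    (F `<=` fset_mul L S)%fset].
Proof.
move=> L1 LV; elim/fset1U_rect: F => [|h F hF [S [SF sepS FS]]].
  by exists fset0; split; rewrite ?fsub0set.
have [hS|hS] := boolP (h \in fset_mul L S).
  exists S; split => //; first exact: fsubset_trans SF (fsubsetUr _ _).
  by rewrite fsubUset fsub1set hS.
have hc c : c \in S -> (h * c^-1)%g \notin L.
  move=> cS; apply: contra hS => hcL; apply/mem_fset_mul.
  by exists (h * c^-1)%g, c; rewrite mulgVK.
exists (h |` S)%fset; split; first by rewrite fsetUS.
  move=> c c'; rewrite !in_fset1U => /orP[/eqP ->|cS] /orP[/eqP ->|c'S].
  - by rewrite eqxx.
  - by move=> _; exact: hc.
  - by move=> _; apply: contra (hc c cS) => /LV; rewrite invgF.
  - exact: sepS.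
apply/fsubsetP => x; rewrite in_fset1U => /orP[/eqP ->|xF].
  by apply/mem_fset_mul; exists 1%g, h; rewrite mul1g in_fset1U eqxx.
have /mem_fset_mul[a [b [aL bS ->]]] := fsubsetP FS _ xF.
by apply/mem_fset_mul; exists a, b; rewrite in_fset1U bS orbT.
Qed.

(** Expansion of the product of |T| factors 1 + C, where J is the set of factors contributing 1. *)
Lemma sum_expn_card (T : finType) (C : nat) :
  (\sum_(J : {set T}) C ^ #|~: J| = C.+1 ^ #|T|)%N.
Proof.
transitivity (\prod_(i : T) (1 + C))%N; last by rewrite prod_nat_const.
rewrite bigA_distr; apply: eq_bigr => J _.
rewrite -prod_nat_const [LHS]big_mkcond; apply: eq_bigr => i _.
by rewrite inE; case: (i \in J).
Qed.

Variables (Z : Type) (act : G -> Z -> Z).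

(** Greedy choice: if n points could not be extended, the sets A around their orbits would form n
    itineraries covering Z. As V need not be symmetric, separation is only asserted for i < j. *)
Lemma separated_family (gamma : {fset (set Z)}) (V : set (Z * Z)) F n :
  Z -> is_cover gamma ->
  (forall z, exists2 A : set Z, A \in gamma & forall y, V (z, y) -> A y) ->
  (n <= cover_num act gamma F)%N ->
  exists y : nat -> Z, forall i j, (i < j < n)%N ->
    exists2 g, g \in F & ~ V (act g (y i), act g (y j)).
Proof.
move=> z0 cg lebV; elim: n => [|n IH] Hn.
  by exists (fun=> z0) => i j /andP[_].
have [|y Hy] := IH; first exact: ltnW.
have [z Hz] : exists z, forall i, (i < n)%N ->
    exists2 g, g \in F & ~ V (act g (y i), act g z).
  apply: contrapT => nz; move: Hn; rewrite ltnNge => /negP; apply.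
  have /choice[A HA] z : exists A : set Z, A \in gamma /\ forall y, V (z, y) -> A y.
    by have [A] := lebV z; exists A.
  rewrite -[X in (_ <= X)%N](card_ord n).
  apply: (@cover_num_le _ _ _ _ _ _ (fun (i : 'I_n) g => A (act g (y i)))).
  split=> [i g _|z]; first exact: (HA _).1.
  apply: contrapT => ni; apply: nz; exists z => i lti.
  apply: contrapT => ng; apply: ni; exists (Ordinal lti) => g gF.
  by apply: (HA _).2; apply: contrapT => nV; apply: ng; exists g.
exists (fun i => if (i < n)%N then y i else z) => i j /andP[ij].
rewrite ltnS leq_eqVlt => /orP[/eqP Ej|jn].
  by rewrite Ej ltnn -Ej ij; apply: Hz; rewrite -Ej.
by rewrite jn (ltn_trans ij jn); apply: Hy; rewrite ij.
Qed.

End Counting.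

Section Gap.
Variables (G : groupType) (X : topologicalType) (act : G -> X -> X).
Variables (Y : set X) (invY : invariant_set act Y).
Hypothesis cptX : compact [set: X].
Hypothesis t2X : hausdorff_space X.
Hypothesis actX : continuous_action act.
Hypothesis clY : closed Y.
Hypothesis specX : weak_specification act.
Local Notation actY := (restricted_action invY).

(** Weak specification for the singletons of S and the one set F \ L S. Making L symmetric ensures
    disjointness for both orders of each pair. *)
Lemma shadowing (U : set (X * X)) (x0 : X) : compact_entourage U ->
  exists L : {fset G}, [/\ 1%g \in L, forall g, g \in L -> g^-1%g \in L &
    forall (S F : {fset G}) (x : X),
    (forall c c', c \in S -> c' \in S -> c != c' -> (c * c'^-1)%g \notin L) ->
    exists z, (forall c, c \in S -> U (act c z, x0)) /\
      forall g, g \in F -> g \notin fset_mul L S -> U (act g z, act g x)].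
Proof.
have [act1 actM _] := actX.
move=> entU; have [Lam HLam] := specX entU.
pose L := ([fset 1%g] `|` (Lam `|` [fset g^-1%g | g in Lam]))%fset.
have LV g : g \in L -> g^-1%g \in L.
  rewrite !in_fsetU !in_fset1 => /orP[/eqP ->|/orP[gL|/imfsetP[h /= hL ->]]].
  - by rewrite invg1 eqxx.
  - by apply/orP; right; apply/orP; right; apply/imfsetP; exists g.
  - by rewrite invgK hL orbT.
have LamL g : g \in Lam -> g \in L by rewrite !in_fsetU => ->; rewrite orbT.
exists L; split => //; first by rewrite in_fsetU in_fset1 eqxx.
move=> S F x sepS.
pose Om (i : option S) := if i is Some c then [fset fsval c]%fset
  else (F `\` fset_mul L S)%fset.
(* The point c^-1 x0 is carried to x0 at time c. *)
pose xs (i : option S) := if i is Some c then act (fsval c)^-1%g x0 else x.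
have [|z Hz] := HLam _ Om _ xs.
  move=> j k jk; apply/eqP; rewrite -fsubset0; apply/fsubsetP => h.
  rewrite in_fsetI => /andP[hj /mem_fset_mul[g [h' [gL hk Eh]]]]; exfalso.
  case: j k jk hj hk => [c|] [c'|] //= jk.
  - rewrite !in_fset1 => /eqP Ec /eqP Ec'.
    have := sepS (fsval c) (fsval c') (fsvalP c) (fsvalP c').
    rewrite -Ec -Ec' Eh mulgK LamL // => /(_ _)/negP; apply => //.
    rewrite -Eh Ec Ec'; apply: contraNneq jk => /val_inj ->; exact: eqxx.
  - rewrite in_fset1 in_fsetD => /eqP Ec /andP[/negP + _]; apply.
    apply/mem_fset_mul; exists g^-1%g, (fsval c); split => //; last first.
      by rewrite -Ec Eh mulKg.
    by apply: LV; exact: LamL.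
  - rewrite in_fset1 in_fsetD => /andP[/negP + _] /eqP Ec'; apply.
    apply/mem_fset_mul; exists g, (fsval c'); split => //; first exact: LamL.
    by rewrite Eh Ec'.
exists z; split=> [c cS|g gF gL].
  have := Hz (Some [` cS]%fset) c; rewrite /= in_fset1 => /(_ (eqxx _)).
  by rewrite -actM mulgV act1.
by apply: (Hz None); rewrite in_fsetD gL.
Qed.

(** The bound N(gamma, F) (1 + 1/C)^m <= N(beta, F) with C = |gamma|^|L| and m = |S|, denominators
    cleared. *)
Lemma cover_num_gap (gamma : {fset (set Y)}) (y0 : Y) (x0 : X) :
  open_cover gamma -> ~ Y x0 ->
  exists2 beta : {fset (set X)}, open_cover beta &
  exists2 L : {fset G}, 1%g \in L & forall F : {fset G}, exists m : nat,
    (#|` F| <= #|` L| * m)%N /\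
    (cover_num actY gamma F * (#|` gamma| ^ #|` L|).+1 ^ m <=
       (#|` gamma| ^ #|` L|) ^ m * cover_num act beta F)%N.
Proof.
move=> ocg Yx0.
have cg : is_cover gamma := ocg.2.
have cptY := set_type_compact cptX clY; have t2Y := @set_type_hausdorff X Y t2X.
have [V entV lebV] := lebesgue_entourage cptY t2Y ocg.
have [V' entV' [V'V V'x0]] := entourage_extension t2X clY Yx0 entV.
have [U entU splitU] := entourage_split3 cptX t2X entV'.
have [beta ocb betaU] := entourage_open_cover cptX entU.
have cb : is_cover beta := ocb.2.
have [L [L1 LV shadow]] := shadowing x0 entU.
exists beta => //; exists L => // F.
have [S [SF sepS FS]] := maximal_separated F L1 LV.
exists #|` S|; split.
  exact: leq_trans (fsubset_leq_card FS) (card_fset_mul_le _ _).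
set C := (#|` gamma| ^ #|` L|)%N.
pose fs (J : {set S}) : {fset G} := [fset fsval c | c in J]%fset.
have mem_fs J (c : S) : (fsval c \in fs J) = (c \in J).
  apply/imfsetP/idP => /= [[c' c'J /val_inj ->]//|cJ]; by exists c.
have fsS J : (fs J `<=` S)%fset.
  by apply/fsubsetP => _ /imfsetP[c _ ->]; exact: fsvalP.
pose W J := (F `\` fset_mul L (fs J))%fset.
(* The times of F lost around J lie in L J, which has at most |L| |J| elements. *)
have cardW J : (cover_num actY gamma F <= cover_num actY gamma (W J) * C ^ #|J|)%N.
  have FW : (F `<=` W J `|` fset_mul L (fs J))%fset.
    by apply/fsubsetP => g gF; rewrite in_fsetU in_fsetD gF andbT orNb.
  apply: leq_trans (cover_numS _ cg FW) _.
  apply: leq_trans (cover_numU _ _ _ cg) _; rewrite leq_mul2l.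
  apply/orP; right; apply: leq_trans (cover_num_exp _ _ cg) _.
  rewrite -expnM leq_pexp2l //.
    exact: leq_trans (cover_num_gt0 actY [fset 1%g]%fset cg y0) (cover_num1 _ _ cg).
  apply: leq_trans (card_fset_mul_le _ _) _.
  rewrite leq_mul2l; apply/orP; right.
  by apply: leq_trans (leq_imfset_card _ _ _) _; rewrite cardE.
have /choice[y Hy] J : exists y : nat -> Y, forall i j,
    (i < j < cover_num actY gamma (W J))%N ->
    exists2 g, g \in W J & ~ V (actY g (y i), actY g (y j)).
  exact: (separated_family y0 cg lebV).
have /choice[z Hz] (Ji : {set S} * nat) : exists z,
    (forall c, c \in fs Ji.1 -> U (act c z, x0)) /\
    forall g, g \in F -> g \notin fset_mul L (fs Ji.1) ->
      U (act g z, act g (set_val (y Ji.1 Ji.2))).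
  apply: shadow => c c' /(fsubsetP (fsS _)) cS /(fsubsetP (fsS _)).
  exact: sepS.
(* At time c the first point is near x0 and the second near Y, since separation keeps c out of L J'.
   A common member of [beta] would contradict the choice of V' at x0. *)
have sepJ (J J' : {set S}) (i i' : nat) (c : S) (A : set X) :
    c \in J -> c \notin J' -> A \in beta ->
    A (act (fsval c) (z (J, i))) -> A (act (fsval c) (z (J', i'))) -> False.
  move=> cJ cJ' Ab Az Az'.
  have Ux0 := (Hz (J, i)).1 (fsval c); rewrite mem_fs in Ux0.
  have Uy := (Hz (J', i')).2 (fsval c) (fsubsetP SF _ (fsvalP c)).
  apply: (V'x0 (actY (fsval c) (y J' i'))).
  apply: splitU (Uy _) (Ux0 cJ) (betaU _ Ab _ _ Az' Az).
  apply/negP => /mem_fset_mul[l [h [lL hJ' Ec]]].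
  have hS := fsubsetP (fsS _) _ hJ'.
  have := sepS (fsval c) h (fsvalP c) hS; rewrite {2}Ec mulgK lL.
  move=> /(_ _)/negP; apply => //; apply: contraNneq cJ' => ch.
  by rewrite -mem_fs ch.
have sepy (J : {set S}) (i j : nat) (A : set X) (g : G) :
    g \in W J -> ~ V (actY g (y J i), actY g (y J j)) ->
    A \in beta -> A (act g (z (J, i))) -> A (act g (z (J, j))) -> False.
  rewrite in_fsetD => /andP[gL gF] nV Ab Ai Aj; apply: nV; apply: V'V.
  exact: splitU ((Hz (J, i)).2 g gF gL) ((Hz (J, j)).2 g gF gL)
    (betaU _ Ab _ _ Ai Aj).
(* The separated points are indexed by a subset J and a member of the separated family chosen for
   [W J]. *)
pose T := {J : {set S} & 'I_(cover_num actY gamma (W J))}.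
have cardT : (#|{: T}| <= cover_num act beta F)%N.
  apply: (@card_separated_le _ _ act _
    (fun t : T => z (tag t, val (tagged t)))) => //.
  move=> [J i] [J' i'] /= ne; have [EJ|neJ] := eqVneq J J'; last first.
    have [c cJ] : exists c, (c \in J) != (c \in J').
      apply: contrapT => nc; move/eqP: neJ; apply; apply/setP => c.
      by apply/eqP; apply: contra_notT nc => cJ; exists c.
    exists (fsval c); first exact: (fsubsetP SF _ (fsvalP c)).
    move=> A Ab Az Az'; move: cJ.
    case: (boolP (c \in J)) => cJ; case: (boolP (c \in J')) => cJ' // _.
      exact: sepJ cJ cJ' Ab Az Az'.
    exact: sepJ cJ' cJ Ab Az' Az.
  subst J'; have WF g : g \in W J -> g \in F by rewrite in_fsetD => /andP[].
  have [ii'|i'i|ii'] := ltngtP (i : nat) i'.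
  - have [|g gW nV] := Hy J i i'; first by rewrite ii' /=.
    by exists g; [exact: WF | move=> A Ab Ai Ai'; exact: sepy gW nV Ab Ai Ai'].
  - have [|g gW nV] := Hy J i' i; first by rewrite i'i /=.
    by exists g; [exact: WF | move=> A Ab Ai Ai'; exact: sepy gW nV Ab Ai' Ai].
  - by exfalso; move/negP: ne; apply; apply/eqP; congr existT; exact: val_inj.
have ET : #|{: T}| = (\sum_(J : {set S}) cover_num actY gamma (W J))%N.
  rewrite card_tagged sumnE big_map big_enum /=.
  by apply: eq_bigr => J _; rewrite card_ord.
(* Termwise in J: N(gamma, F) C^|~J| <= N(gamma, W J) C^|J| C^|~J| = N(gamma, W J) C^|S|. *)
apply: leq_trans (leq_mul (leqnn _) cardT); rewrite ET cardfE -sum_expn_card.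
rewrite !big_distrr /=; apply: leq_sum => J _.
rewrite -(cardsC J) expnD [X in (_ <= X)%N]mulnAC leq_mul //.
by rewrite mulnC; exact: cardW.
Qed.

End Gap.

(** * Comparison of the entropies of Y and X *)

Section Comparison.
Variables (R : realType) (G : groupType).
Hypothesis amG : amenable R G.
Implicit Types (F K : {fset G}) (d e : R).

(** The empty family is a subcover, so N = 0 and every rate is -oo. *)
Lemma cover_entropy_empty (Z : Type) (act : G -> Z -> Z)
    (alpha : {fset (set Z)}) : (Z -> False) ->
  cover_entropy R act alpha = -oo%E.
Proof.
move=> nZ; apply: cover_entropy_eq => // J F [F0 _].
rewrite (_ : (fun j => _) = cst -oo%E); first exact: cvg_cst.
apply/funext => j /=; rewrite /cover_rate (_ : min_subcover _ = 0%N).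
  rewrite le0_lneNy // gt0_mulNye // lte_fin invr_gt0; exact: card_gt0R.
apply/eqP; rewrite -leqn0 -[X in (_ <= X)%N]card_void.
apply: (@cover_num_le _ _ act alpha (F j) _ (fun (i : void) _ => setT)).
by split=> [[]|z] //; case: (nZ z).
Qed.

(** Subadditivity over F and K F \ F, the latter costing at most log |gamma| per element. *)
Lemma cover_log_mul_le (Z : Type) (act : G -> Z -> Z) (gamma : {fset (set Z)})
    K F : is_cover gamma -> Z ->
  cover_log R act gamma (fset_mul K F) <= cover_log R act gamma F +
    ln #|` gamma|%:R * \sum_(k <- K) #|` fset_lmul k F `\` F|%fset%:R.
Proof.
move=> cg z.
have num0 E : (0 < cover_num act gamma E)%N by exact: cover_num_gt0.
have numR E : 0 < (cover_num act gamma E)%:R :> R by rewrite ltr0n.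
have g0 : (0 < #|` gamma|)%N.
  exact: leq_trans (num0 [fset 1%g]%fset) (cover_num1 _ _ cg).
have sub : (fset_mul K F `<=` F `|` (fset_mul K F `\` F))%fset.
  by apply/fsubsetP => x xK; rewrite in_fsetU in_fsetD xK andbT orbN.
apply: (@le_trans _ _ (cover_log R act gamma F + ln #|` gamma|%:R *
    #|` fset_mul K F `\` F|%fset%:R)).
  rewrite /cover_log mulr_natr -lnXn ?ltr0n // -lnM ?posrE ?exprn_gt0 ?ltr0n //.
  rewrite -natrX -natrM ler_ln_nat //.
  apply: leq_trans (cover_numS _ cg sub) _.
  apply: leq_trans (cover_numU _ _ _ cg) _.
  by rewrite leq_mul2l cover_num_exp ?orbT.
rewrite lerD2l ler_wpM2l ?ln_ge0 ?ler1n //.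
by rewrite -natr_sum ler_nat card_fset_mulD_le.
Qed.

Lemma folner_limit_refine (Z : Type) (act : G -> Z -> Z)
    (alpha gamma : {fset (set Z)}) K (la lg : R) : Z ->
  (forall g h z, act (g * h)%g z = act g (act h z)) ->
  is_cover alpha -> is_cover gamma ->
  (forall phi : G -> set Z, (forall k, k \in K -> phi k \in gamma) ->
    exists2 A, A \in alpha &
      [set z | forall k, k \in K -> phi k (act k z)] `<=` A) ->
  folner_limit (cover_log R act alpha) la ->
  folner_limit (cover_log R act gamma) lg -> la <= lg.
Proof.
move=> z actM ca cg ref lima limg; rewrite -[lg]addr0.
apply: (folner_limit_le amG lima limg) => e e0.
have g0 : 0 <= ln #|` gamma|%:R :> R.
  rewrite ln_ge0 // ler1n.
  exact: leq_trans (cover_num_gt0 act [fset 1%g]%fset cg z) (cover_num1 _ _ cg).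
(* The summand 1 keeps b positive even if [gamma] has one member or K is empty. *)
pose b : R := ln #|` gamma|%:R * #|` K|%:R + 1.
have b0 : 0 < b by rewrite ltr_wpDl // mulr_ge0.
exists K, (e / b); split; first exact: divr_gt0.
move=> F iF; apply: (@le_trans _ _ (cover_log R act gamma (fset_mul K F))).
  rewrite ler_ln_nat //; first exact: cover_num_gt0.
  exact: cover_num_refine.
apply: le_trans (cover_log_mul_le _ _ _ cg z) _; rewrite lerD2l add0r.
have : \sum_(k <- K) #|` fset_lmul k F `\` F|%fset%:R <=
    \sum_(k <- K) e / b * #|` F|%:R :> R.
  rewrite big_seq [X in _ <= X]big_seq; apply: ler_sum => k kK; exact: iF.2.
rewrite big_const_seq count_predT iter_addr_0 -[X in _ <= X -> _]mulr_natl.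
move=> /(ler_wpM2l g0) /le_trans; apply.
rewrite [leLHS](_ : _ =
  (e * #|` F|%:R) * ((ln #|` gamma|%:R * #|` K|%:R) / b)); last by ring.
rewrite ler_piMr ?mulr_ge0 ?(ltW e0) //.
by rewrite ler_pdivrMr // mul1r lerDl.
Qed.

Variables (X : topologicalType) (act : G -> X -> X).
Variables (Y : set X) (invY : invariant_set act Y).
Hypothesis cptX : compact [set: X].
Hypothesis t2X : hausdorff_space X.
Hypothesis actX : continuous_action act.
Hypothesis clY : closed Y.
Hypothesis specX : weak_specification act.
Local Notation actY := (restricted_action invY).

(** Logarithms in [cover_num_gap]: as m >= |F| / |L|, the factor ((C + 1) / C)^m becomes a gain
    linear in |F|. *)
Lemma cover_log_gap (gamma : {fset (set Y)}) (y0 : Y) (x0 : X) :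
  open_cover gamma -> ~ Y x0 ->
  exists2 beta : {fset (set X)}, open_cover beta &
  exists2 delta : R, 0 < delta & forall F,
    cover_log R actY gamma F + delta * #|` F|%:R <= cover_log R act beta F.
Proof.
move=> ocg Yx0.
have [beta ocb [L L1 gap]] :=
  cover_num_gap invY cptX t2X actX clY specX y0 ocg Yx0.
exists beta => //; set C := (#|` gamma| ^ #|` L|)%N in gap.
have g0 : (0 < #|` gamma|)%N.
  exact: leq_trans (cover_num_gt0 actY [fset 1%g]%fset ocg.2 y0)
                   (cover_num1 _ _ ocg.2).
have C0 : (0 < C)%N by rewrite expn_gt0 g0.
have L0 : 0 < #|` L|%:R :> R by rewrite card_gt0R //; apply/fset0Pn; exists 1%g.
have lnC : 0 < ln C.+1%:R - ln C%:R :> R.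
  by rewrite subr_gt0 ltr_ln ?posrE ?ltr0n // ltr_nat.
exists ((ln C.+1%:R - ln C%:R) / #|` L|%:R); first exact: divr_gt0.
move=> F; have [m [Fm num]] := gap F.
have ng0 : (0 < cover_num actY gamma F)%N by exact: cover_num_gt0 ocg.2 y0.
have nb0 : (0 < cover_num act beta F)%N by exact: cover_num_gt0 ocb.2 x0.
have : ln ((cover_num actY gamma F)%:R * C.+1%:R ^+ m) <=
       ln (C%:R ^+ m * (cover_num act beta F)%:R) :> R.
  by rewrite -!natrX -!natrM ler_ln_nat // muln_gt0 ng0 expn_gt0.
rewrite !lnM ?posrE ?exprn_gt0 ?ltr0n // !lnXn ?ltr0n //.
rewrite -[ln C.+1%:R *+ m]mulr_natr -[ln C%:R *+ m]mulr_natr.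
have : (ln C.+1%:R - ln C%:R) / #|` L|%:R * #|` F|%:R <=
       (ln C.+1%:R - ln C%:R) * m%:R :> R.
  rewrite -mulrA ler_pM2l // ler_pdivrMl // -natrM ler_nat; exact: Fm.
rewrite /cover_log; lra.
Qed.

Lemma topological_entropy_ltNy (x0 : X) : (-oo < topological_entropy R act)%E.
Proof.
have [_ actM _] := actX.
pose alpha : {fset (set X)} := [fset [set: X]]%fset.
have oca : open_cover alpha.
  split=> [A|]; first by rewrite inE => /eqP ->; exact: openT.
  by apply/is_coverP => z; exists setT; rewrite ?inE.
have [l El _] := cover_entropy_lim actM amG oca.2 x0.
apply: (@lt_le_trans _ _ l%:E); first exact: ltNyr.
by apply: ereal_sup_ubound; exists alpha.
Qed.

Lemma topological_entropy_expansive_lt (x0 : X) : ~ Y x0 -> expansive actY ->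
  (topological_entropy R actY < topological_entropy R act)%E.
Proof.
move=> Yx0 expY; have [act1 actM act_cont] := actX.
(* For empty Y the left side is -oo, while the one-set cover gives X an entropy above -oo. *)
have [[y0]|nY] := pselect (inhabited Y); last first.
  apply: le_lt_trans (topological_entropy_ltNy x0).
  apply: ge_ereal_sup => _ [alpha _ <-].
  by rewrite cover_entropy_empty // => y; apply: nY.
have cptY := set_type_compact cptX clY; have t2Y := @set_type_hausdorff X Y t2X.
have actYM := restricted_actionM invY actM.
have actY_cont g : continuous (actY g).
  by apply: restricted_action_continuous; exact: act_cont.
have [gamma ocg gen] := expansive_generator cptY t2Y actY_cont y0 expY.
have [lg _ limg] := cover_entropy_lim actYM amG ocg.2 y0.
have [beta ocb [delta delta0 gap]] := cover_log_gap y0 ocg Yx0.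
have [lb Eb limb] := cover_entropy_lim actM amG ocb.2 x0.
have lgb : lg <= lb + - delta.
  apply: (folner_limit_le amG limg limb) => e e0.
  exists fset0, 1; split => // F _; have := gap F.
  have : 0 <= e * #|` F|%:R by rewrite mulr_ge0 // ltW.
  rewrite mulrDl mulNr; lra.
(* As [gamma] is a generator, its entropy bounds that of every open cover of Y. *)
apply: (@le_lt_trans _ _ lg%:E).
  apply: ge_ereal_sup => _ [alpha oca <-].
  have [la -> lima] := cover_entropy_lim actYM amG oca.2 y0.
  have [K refK] := gen _ oca.
  rewrite lee_fin; exact: folner_limit_refine y0 actYM oca.2 ocg.2 refK lima limg.
apply: (@lt_le_trans _ _ lb%:E); first by rewrite lte_fin; lra.
by rewrite -Eb; apply: ereal_sup_ubound; exists beta.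
Qed.

End Comparison.

Theorem theorem7p1 (R : realType) (G : groupType) (X : topologicalType)
    (act : G -> X -> X) (Y : set X) (invY : invariant_set act Y) :
  amenable R G ->
  compact [set: X] ->
  hausdorff_space X ->
  continuous_action act ->
  closed Y ->
  Y `<` [set: X] ->
  weak_specification act ->
  expansive (restricted_action invY) ->
  (topological_entropy R (restricted_action invY)
     < topological_entropy R act)%E.
Proof.
move=> amG cptX t2X actX clY [_ nYX] specX expY.
have [x0 Yx0] : exists x0, ~ Y x0.
  apply: contrapT => nx0; apply: nYX => x _.
  by apply: contrapT => Yx; apply: nx0; exists x.
exact: (topological_entropy_expansive_lt amG cptX t2X actX clY specX Yx0).
Qed.
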